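(* Let $\rho,T>0$, $\theta\ge0$, $N\ge2$, $\alpha:=e^{-\rho T/N}$, $\kappa:=2\theta+\frac12$, and let $\bm\omega,\bm\nu,\delta_k,\phi_k$ be as in the context. Then for all $i\in\{1,\dots,N+1\}$, $$\omega_i=\frac{(1-\alpha)\kappa+\alpha\big(\frac{\alpha(\kappa-1)}{\kappa}\big)^{N+1-i}}{\kappa(\kappa-\alpha(\kappa-1))},$$ in particular $\omega_{N+1}=1/\kappa$. Moreover, $$\nu_1=\frac{1-\alpha}{\delta_{N+1}}\Big(\phi_2+(1-\alpha)\sum_{j=2}^N(\alpha\kappa)^{j-1}\phi_{j+1}+(\alpha\kappa)^N\Big),$$ $$\nu_{N+1}=\frac{1-\alpha}{\delta_{N+1}}\Big((\alpha(\kappa-1))^N+(1-\alpha)\sum_{j=2}^N(\alpha(\kappa-1))^{N+1-j}\delta_{j-1}+\delta_N\Big),$$ and for $i=2,\dots,N$, $$\nu_i=\frac{1-\alpha}{\delta_{N+1}}\Big((\alpha(\kappa-1))^{i-1}\phi_{i+1}+(1-\alpha)\sum_{j=2}^{i-1}(\alpha(\kappa-1))^{i-j}\delta_{j-1}\phi_{i+1}+(1-\alpha)\sum_{j=i}^N(\alpha\kappa)^{j-i}\delta_{i-1}\phi_{j+1}+(\alpha\kappa)^{N+1-i}\delta_{i-1}\Big).$$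
   Context: Let $\tilde\Gamma$ be the $(N+1)\times(N+1)$ lower triangular matrix with $\tilde\Gamma_{ij}=0$ for $i<j$, $\tilde\Gamma_{ii}=1/2$, $\tilde\Gamma_{ij}=\alpha^{i-j}$ for $i>j$, $\Gamma:=\tilde\Gamma+\tilde\Gamma^\top$, $\bm\nu=(\nu_1,\dots,\nu_{N+1})^\top:=(\Gamma+\tilde\Gamma+2\theta\mathrm{Id})^{-1}\mathbf1$ and $\bm\omega=(\omega_1,\dots,\omega_{N+1})^\top:=(\Gamma-\tilde\Gamma+2\theta\mathrm{Id})^{-1}\mathbf1$ (both matrices are invertible), where $\mathbf1$ is the all-ones vector. Let $B:=(1-\alpha^2)(\mathrm{Id}+\Gamma^{-1}(\tilde\Gamma+2\theta\mathrm{Id}))$ (a tridiagonal matrix with diagonal $(1-2\alpha^2+\kappa,1+\alpha^2(\kappa-2)+\kappa,\dots,1+\alpha^2(\kappa-2)+\kappa,1-\alpha^2+\kappa)$, superdiagonal $-\alpha\kappa$, subdiagonal $-\alpha(\kappa-1)$); $\delta_k$ ($1\le k\le N+1$) is its $k$-th leading principal minor and $\delta_0:=1$. Define $\phi_{N+2}:=1$, $\phi_{N+1}:=1-\alpha^2+\kappa$ and $\phi_k:=(1+\alpha^2(\kappa-2)+\kappa)\phi_{k+1}-\alpha^2\kappa(\kappa-1)\phi_{k+2}$ for $k=N,\dots,2$. *)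

(* Defs.v *)
From HB Require Import structures.
From mathcomp Require Import all_boot all_order all_algebra.
From mathcomp Require Import all_classical all_reals all_analysis.
Set Implicit Arguments. Unset Strict Implicit. Unset Printing Implicit Defensive.
Import Order.TTheory GRing.Theory Num.Theory.
Local Open Scope ring_scope.

Section Defs.
Variables (R : realType).

(* Matrices of size n = N+1, indices 0..N (paper index = our index + 1). *)

Definition tGamma (n : nat) (a : R) : 'M[R]_n :=
  \matrix_(i < n, j < n)
    (if (i < j)%N then 0 else if i == j then 1/2 else a ^+ (i - j)).

Definition Gamma (n : nat) (a : R) : 'M[R]_n := tGamma n a + (tGamma n a)^T.

Definition ones (n : nat) : 'cV[R]_n := const_mx 1.

Definition nuvec (n : nat) (a theta : R) : 'cV[R]_n :=
  invmx (Gamma n a + tGamma n a + (2 * theta)%:M) *m ones n.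

Definition omegavec (n : nat) (a theta : R) : 'cV[R]_n :=
  invmx (Gamma n a - tGamma n a + (2 * theta)%:M) *m ones n.

Definition Bmat (n : nat) (a theta : R) : 'M[R]_n :=
  (1 - a ^+ 2) *: (1%:M + invmx (Gamma n a) *m (tGamma n a + (2 * theta)%:M)).

(* k-th leading principal minor of B of size n.+1 (for k <= n.+1); delta 0 = 1 *)
Definition delta (n : nat) (a theta : R) (k : nat) : R :=
  \det (\matrix_(i < k, j < k)
          Bmat n.+1 a theta (inord i) (inord j)).

(* phi_{N+2-m} = phiaux m *)
Fixpoint phiaux (a kappa : R) (m : nat) : R :=
  match m with
  | 0 => 1
  | 1 => 1 - a ^+ 2 + kappa
  | (m1.+1 as m2).+1 =>
      (1 + a ^+ 2 * (kappa - 2) + kappa) * phiaux a kappa m2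
      - a ^+ 2 * kappa * (kappa - 1) * phiaux a kappa m1
  end.

(* phi_k for 2 <= k <= N+2, with N = size - 1 *)
Definition phi (N : nat) (a kappa : R) (k : nat) : R :=
  phiaux a kappa (N + 2 - k).

End Defs.

(* Main.v *)
Require Import Defs.
From HB Require Import structures.
From mathcomp Require Import all_boot all_order all_algebra.
From mathcomp Require Import all_classical all_reals all_analysis.
From mathcomp Require Import zify ring lra.
Import Order.TTheory GRing.Theory Num.Theory.
Local Open Scope ring_scope.

(** Gamma is the Kac-Murdock-Szego matrix [a^|i-j|], whose inverse is
    [(1 - a^2)^-1] times an explicit tridiagonal matrix G. Multiplying by G
    turns [(Gamma + tGamma + 2 theta) nu = 1] into the tridiagonal system
    [B nu = G 1], where [G 1 = (1 - a) (1, 1 - a, ..., 1 - a, 1)]. The inverse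
    of B is expressed by its leading principal minors [delta] and the
    backward solution [phi] of the same three-term recurrence. Invertibility
    comes from the quadratic form of tGamma being positive definite. The vector
    omega solves a triangular system, whose rows telescope. *)

(** * Products with tridiagonal matrices and the recurrence of their determinants *)

Section Tridiagonal.
Context {R : comNzRingType}.
Implicit Types (c b : R) (d v : nat -> R).

(** The diagonal is indexed by [nat], so every leading block is again a [tridiag] with the same [c],
    [b], [d]. *)
Definition tridiag c b d (n : nat) : 'M[R]_n :=
  \matrix_(i < n, j < n)
    (if i == j :> nat then d i else if j == i.+1 :> nat then b
     else if i == j.+1 :> nat then c else 0).

Lemma tridiag_mulmx c b d (n p : nat) (F : nat -> nat -> R)
    (i : 'I_n.+1) (k : 'I_p) :
  (tridiag c b d n.+1 *m \matrix_(i < n.+1, k < p) F i k) i k =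
  (if (0 < i)%N then c * F i.-1 k else 0) + d i * F i k
  + (if (i < n)%N then b * F i.+1 k else 0).
Proof.
rewrite mxE.
transitivity (\sum_(j < n.+1)
  ((if (0 < i)%N && (j == i.-1 :> nat) then c * F j k else 0)
   + (if j == i :> nat then d j * F j k else 0)
   + (if j == i.+1 :> nat then b * F j k else 0))).
  apply: eq_bigr => j _; rewrite !mxE.
  have -> : (0 < i)%N && (j == i.-1 :> nat) = (i == j.+1 :> nat) by lia.
  rewrite (eq_sym (j : nat) i).
  have [->|ij] := eqVneq (i : nat) j.
    by rewrite (ltn_eqF (ltnSn _)) add0r addr0.
  have [e|_] := eqVneq (j : nat) i.+1.
    by rewrite e (_ : (_ == _) = false) ?add0r ?addr0 //; lia.
  by case: ifP => _; rewrite ?addr0 ?mul0r.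
rewrite !big_split /= -!big_mkcond /=.
rewrite (big_ord1_eq _ (fun j => d j * F j k)) (big_ord1_eq _ (fun j => b * F j k)).
rewrite ltn_ord ltnS; congr (_ + _ + _).
case: ifP => _ /=; last by rewrite big_pred0.
rewrite (big_ord1_eq _ (fun j => c * F j k)) ifT //.
by have := ltn_ord i; lia.
Qed.

(** Laplace expansion along the last row, which has two nonzero entries; the cofactor of [c] is then
    expanded along its last column, whose only nonzero entry is [b]. *)
Lemma det_tridiag_rec c b d n :
  \det (tridiag c b d n.+2) =
  d n.+1 * \det (tridiag c b d n.+1) - b * c * \det (tridiag c b d n).
Proof.
have minor_max k : row' ord_max (col' ord_max (tridiag c b d k.+1)) = tridiag c b d k.
  by apply/matrixP => i j; rewrite !mxE !lift_max.
rewrite (expand_det_row _ ord_max) big_ord_recr big_ord_recr /= big1 ?add0r; last first.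
  move=> i _; rewrite mxE /= (_ : (_ == _) = false); last by have := ltn_ord i; lia.
  by rewrite !ifF ?mul0r //; have := ltn_ord i; lia.
rewrite addrC; congr (_ + _).
  rewrite mxE eqxx; congr (_ * _).
  by rewrite /cofactor minor_max -signr_odd addnn odd_double mul1r.
set j0 := widen_ord _ ord_max.
have -> : tridiag c b d n.+2 ord_max j0 = c.
  by rewrite mxE /= (gtn_eqF (ltnSn n)) (ltn_eqF (ltnW _)) // eqxx.
rewrite /cofactor (_ : (-1) ^+ (ord_max + j0) = -1 :> R); last first.
  by rewrite -signr_odd addSn addnn /= odd_double.
rewrite (expand_det_col _ ord_max) big_ord_recr /= big1 ?add0r; last first.
  move=> i _; rewrite !mxE /= /bump.
  have := ltn_ord i => ?.
  by rewrite !ifF ?mul0r //; lia.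
rewrite !mxE /= /bump leqnn ltnn /= !add1n !add0n.
rewrite ifF ?eqxx; last by lia.
rewrite /cofactor -signr_odd addnn odd_double mul1r.
set M := row' _ _; have -> : M = tridiag c b d n; last by ring.
have bumpE h x : (x < h)%N -> bump h x = x by rewrite /bump ltnNge => /negbTE ->.
apply/matrixP => i j; have := ltn_ord i; have := ltn_ord j => jn ji.
by rewrite !mxE /= !bumpE // ltnW.
Qed.

End Tridiagonal.

(** * The adjugate of a tridiagonal matrix from its leading and trailing minors *)

Section Inverse.
Context {R : comNzRingType}.
Variables (b c : R) (d P : nat -> R) (N : nat).
Let D k := \det (tridiag (- c) (- b) d k).

Hypothesis P_last : P N = 1.
(** This makes [P k] the trailing minor on the rows [k.+1] to [N]. The guard is needed because
    nothing is assumed about [P N.+1]. *)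
Hypothesis P_rec : forall k, (k < N)%N ->
  P k = d k.+1 * P k.+1 - (if (k.+1 < N)%N then b * c * P k.+2 else 0).

Lemma det_tridiagS k :
  D k.+1 = d k * D k - (if (0 < k)%N then b * c * D k.-1 else 0).
Proof.
case: k => [|k]; last by rewrite /D det_tridiag_rec mulrNN.
by rewrite /D det_mx11 det_mx00 mxE /= subr0 mulr1.
Qed.

(* The discrete Wronskian of the two solutions [D] and [P] of the three-term
   recurrence is constant. *)
Lemma continuant_wronskian i : (i <= N)%N ->
  D i.+1 * P i - (if (i < N)%N then b * c * D i * P i.+1 else 0) = D N.+1.
Proof.
elim/ltn_ind: {i}(N - i)%N {-2}i (erefl (N - i)%N) => m IH i mE iN.
move: iN; rewrite leq_eqVlt => /predU1P[->|iN].
  by rewrite ltnn P_last mulr1 subr0.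
rewrite -(IH (N - i.+1)%N _ i.+1) //; last by lia.
rewrite iN P_rec // (det_tridiagS i.+1) /=.
by case: ifP => _; ring.
Qed.

(** The minor before the smaller index, the minor after the larger one, and the off-diagonal entries
    between them. Taking these entries as [- b] and [- c] absorbs the cofactor signs. *)
Definition tridiag_adj (i j : nat) : R :=
  if (i <= j)%N then b ^+ (j - i) * D i * P j else c ^+ (i - j) * D j * P i.

Lemma tridiag_mul_adj :
  tridiag (- c) (- b) d N.+1 *m \matrix_(i < N.+1, j < N.+1) tridiag_adj i j
  = (D N.+1)%:M.
Proof.
apply/matrixP => i k; rewrite tridiag_mulmx mxE -val_eqE /=.
have := ltn_ord i; have := ltn_ord k; rewrite !ltnS.
move: (i : nat) (k : nat) => {}i {}k kN iN.
have [ik|ki|->] := ltngtP i k; rewrite /tridiag_adj ?mulr0n ?mulr1n.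
(* Above the diagonal the column is a rescaled [D], killed by the recurrence of [D]; below it, a
   rescaled [P], killed by that of [P]; on it, the Wronskian remains. *)
- rewrite (leq_trans (leq_pred i)) ?(ltnW ik) // (leq_trans ik kN) ik.
  rewrite det_tridiagS.
  have -> : (k - i)%N = (k - i.+1).+1 by lia.
  case: posnP => [->|i0]; first by rewrite exprS; ring.
  have -> : (k - i.-1)%N = (k - i.+1).+2 by lia.
  by rewrite !exprS; ring.
- rewrite [(i <= k)%N]leqNgt ki /= (leq_ltn_trans (leq0n k) ki).
  rewrite [(i.+1 <= k)%N]leqNgt ltnS (ltnW ki) /=.
  (* The first branch can occur only for [i.-1 = k], where both branches agree. *)
  have -> : (if (i.-1 <= k)%N then b ^+ (k - i.-1) * D i.-1 * P k
             else c ^+ (i.-1 - k) * D k * P i.-1) = c ^+ (i.-1 - k) * D k * P i.-1.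
    by case: leqP => // ?; rewrite (_ : i.-1 = k) ?subnn //; lia.
  rewrite P_rec ?(ltn_predK ki); last by lia.
  have -> : (i.+1 - k)%N = (i.-1 - k).+2 by lia.
  have -> : (i - k)%N = (i.-1 - k).+1 by lia.
  by case: ifP => _; rewrite !exprS; ring.
- rewrite leqnn leq_pred ltnn subnn -(continuant_wronskian _ kN) det_tridiagS.
  rewrite subSnn.
  case: posnP => k0; first by case: ifP => _; ring.
  have -> : (k - k.-1)%N = 1%N by lia.
  by case: ifP => _; ring.
Qed.

End Inverse.

(** * Invertibility from the quadratic form of [tGamma] *)

Section QuadraticForm.
Context {R : realType}.
Implicit Types (a : R) (v : nat -> R).

Definition decay_sum a v k : R := \sum_(j < k) a ^+ (k - j) * v j.

Lemma decay_sumS a v k : decay_sum a v k.+1 = a * (decay_sum a v k + v k).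
Proof.
rewrite /decay_sum big_ord_recr /= subSnn expr1 mulrDr mulr_sumr; congr (_ + _).
by apply: eq_bigr => j _; rewrite subSn 1?ltnW // exprS mulrA.
Qed.

(* With [q_k = v_k + p_k] for [p = decay_sum a v], one has [p_{k+1} = a q_k],
   and [2 v_k (v_k / 2 + p_k) = q_k^2 - p_k^2] makes the sum telescope. *)
Lemma tGamma_form a v n :
  2 * \sum_(k < n) v k * (v k / 2 + decay_sum a v k) =
  (1 - a ^+ 2) * (\sum_(k < n) (v k + decay_sum a v k) ^+ 2) + decay_sum a v n ^+ 2.
Proof.
elim: n => [|n IH]; first by rewrite /decay_sum !big_ord0; ring.
by rewrite !big_ord_recr /= [LHS]mulrDr IH decay_sumS; field.
Qed.

Lemma tGamma_mulmx n a v (i : 'I_n.+1) :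
  (tGamma n.+1 a *m \col_(j < n.+1) v j) i 0 = v i / 2 + decay_sum a v i.
Proof.
rewrite mxE.
transitivity (\sum_(j < n.+1) ((if j == i :> nat then v j / 2 else 0)
   + (if (j < i)%N then a ^+ (i - j) * v j else 0))).
  apply: eq_bigr => j _; rewrite !mxE -val_eqE /=.
  by case: ltngtP => _; rewrite ?mul0r ?addr0 ?add0r //; ring.
rewrite big_split -!big_mkcond /= (big_ord1_eq _ (fun j => v j / 2)) ltn_ord.
by rewrite /decay_sum (big_ord_widen n.+1 (fun j => a ^+ (i - j) * v j)) // ltnW.
Qed.

(** A matrix and its transpose have the same quadratic form, so only [s + t] matters. The matrix of
    [nu] is the case [s = 2], [t = 1], that of [omega] the case [s = 0], [t = 1]. *)
Lemma unitmx_tGamma n a s t u : a ^+ 2 < 1 -> 0 < s + t -> 0 <= u ->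
  s *: tGamma n.+1 a + t *: (tGamma n.+1 a)^T + u%:M \in unitmx.
Proof.
move=> a1 st0 u0; rewrite unitmxE unitfE; apply/det0P => -[x x0 xM].
pose v j := x 0 (inord j).
have xE : x^T = \col_(j < n.+1) v j.
  by apply/colP => j; rewrite !mxE /v inord_val.
have qE : (x *m tGamma n.+1 a *m x^T) 0 0 =
    \sum_(k < n.+1) v k * (v k / 2 + decay_sum a v k).
  rewrite -mulmxA mxE; apply: eq_bigr => j _.
  by rewrite xE tGamma_mulmx /v inord_val.
have q0 : (s + t) * (x *m tGamma n.+1 a *m x^T) 0 0 + u * (x *m x^T) 0 0 = 0.
  have := congr1 (fun y : 'rV_n.+1 => (y *m x^T) 0 0) xM.
  rewrite /= mul0mx [RHS]mxE => <-.
  rewrite !(mulmxDr, mulmxDl) -!scalemxAr -!scalemxAl mul_mx_scalar -scalemxAl.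
  have -> : x *m (tGamma n.+1 a)^T *m x^T = (x *m tGamma n.+1 a *m x^T)^T.
    by rewrite !trmx_mul trmxK mulmxA.
  by rewrite !mxE; ring.
have xx0 : 0 <= (x *m x^T) 0 0.
  by rewrite mxE sumr_ge0 // => j _; rewrite mxE -expr2 sqr_ge0.
have := tGamma_form a v n.+1; rewrite -qE.
set S := \sum_(k < _) _; set q := (_ *m _) 0 0 in q0 *.
have S0 : 0 <= S by apply: sumr_ge0 => k _; exact: sqr_ge0.
have q_le0 : q <= 0.
  by rewrite -(pmulr_rle0 _ st0) -(addrK (u * (x *m x^T) 0 0) (_ * q)) q0 sub0r
    oppr_le0 mulr_ge0.
have sq0 := sqr_ge0 (decay_sum a v n.+1) => qS.
(* As [q <= 0], the identity [tGamma_form] forces the sum of squares to vanish; then [decay_sumS]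
   gives that all [decay_sum a v k], and hence all [v k], are zero. *)
have {}S0 : S = 0.
  apply/eqP; rewrite eq_le S0 andbT -(pmulr_rle0 S (_ : 0 < 1 - a ^+ 2)) ?subr_gt0 //.
  by lra.
have vp k : (k < n.+1)%N -> v k + decay_sum a v k = 0.
  move=> kn; apply/eqP; rewrite -sqrf_eq0; apply/eqP.
  have /psumr_eq0P/(_ S0 (Ordinal kn) isT) : forall i : 'I_n.+1, true ->
      0 <= (v i + decay_sum a v i) ^+ 2 by move=> i _; exact: sqr_ge0.
  by [].
have p0 k : (k <= n)%N -> decay_sum a v k = 0.
  elim: k => [|k IH] kn; first by rewrite /decay_sum big_ord0.
  by rewrite decay_sumS addrC vp ?mulr0 // ltnW.
case/eqP: x0; apply/rowP => j; rewrite mxE.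
by have := vp j (ltn_ord j); rewrite (p0 _ (ltn_ord j)) addr0 /v inord_val.
Qed.

End QuadraticForm.

(** * The matrices of the model in tridiagonal form, and the two linear systems *)

Section KernelMatrices.
Context {R : realType}.
Implicit Types (a k u : R).

Definition invGamma_diag a N i : R := if (0 < i < N)%N then 1 + a ^+ 2 else 1.

Definition Bdiag a k N i : R :=
  if i == 0%N then 1 - 2 * a ^+ 2 + k
  else if i == N then 1 - a ^+ 2 + k
  else 1 + a ^+ 2 * (k - 2) + k.

(** Away from the diagonal, the columns of [Gamma] are geometric with ratio [a] or its inverse, so
    the three-term rows annihilate them; the diagonal entry 1 of the end rows does the same with two
    terms. *)
Lemma tridiag_Gamma a N : (0 < N)%N ->
  tridiag (- a) (- a) (invGamma_diag a N) N.+1 *m Gamma N.+1 a = (1 - a ^+ 2)%:M.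
Proof.
move=> N0.
(* Truncated subtraction: one of the two exponents is 0. *)
have -> : Gamma N.+1 a =
    \matrix_(i < N.+1, j < N.+1) (a ^+ (i - j) * a ^+ (j - i)).
  apply/matrixP => i j; rewrite !mxE -!val_eqE /=.
  case: ltngtP => [ij|ij|->]; last by rewrite subnn expr0; field.
    by rewrite add0r (eqP (ltnW ij)) mul1r.
  by rewrite addr0 (eqP (ltnW ij)) mulr1.
apply/matrixP => i j.
rewrite (tridiag_mulmx _ _ _ _ _ (fun i j => a ^+ (i - j) * a ^+ (j - i))).
rewrite mxE -val_eqE /= /invGamma_diag.
have := ltn_ord i; have := ltn_ord j; rewrite !ltnS.
move: (i : nat) (j : nat) => {}i {}j jN iN.
have [ij|ji|<-] := ltngtP i j; rewrite ?mulr0n ?mulr1n.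
- have -> : (i - j)%N = 0%N by lia.
  have -> : (i.-1 - j)%N = 0%N by lia.
  have -> : (i.+1 - j)%N = 0%N by lia.
  have -> : (j - i)%N = (j - i.+1).+1 by lia.
  rewrite (leq_trans ij jN); case: posnP => i0 /=.
    by rewrite !exprS expr0; ring.
  have -> : (j - i.-1)%N = (j - i.+1).+2 by lia.
  by rewrite !exprS expr0; ring.
- have -> : (j - i)%N = 0%N by lia.
  have -> : (j - i.+1)%N = 0%N by lia.
  have -> : (j - i.-1)%N = 0%N by lia.
  have -> : (i.+1 - j)%N = (i.-1 - j).+2 by lia.
  have -> : (i - j)%N = (i.-1 - j).+1 by lia.
  rewrite (leq_ltn_trans (leq0n _) ji) /=.
  by case: ltnP => _; rewrite !exprS expr0; ring.
- have -> : (i - i.+1)%N = 0%N by lia.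
  have -> : (i.-1 - i)%N = 0%N by lia.
  rewrite subSnn subnn; case: posnP => [->|i0] /=; first by rewrite N0; ring.
  have -> : (i - i.-1)%N = 1%N by lia.
  by case: ltnP => _; ring.
Qed.

Lemma tridiag_tGamma a u N : (0 < N)%N ->
  let k := u + 1 / 2 in
  tridiag (- a) (- a) (invGamma_diag a N) N.+1 *m (tGamma N.+1 a + u%:M) =
  tridiag (- (a * (k - 1))) (- (a * k)) (Bdiag a k N) N.+1 - (1 - a ^+ 2)%:M.
Proof.
move=> N0 k.
pose F i j : R := if (i < j)%N then 0 else if i == j then k else a ^+ (i - j).
have -> : tGamma N.+1 a + u%:M = \matrix_(i < N.+1, j < N.+1) F i j.
  apply/matrixP => i j; rewrite !mxE /F -!val_eqE /=.
  case: ltngtP => ij; rewrite ?mulr0n ?addr0 // mulr1n.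
  by rewrite addrC.
apply/matrixP => i j; rewrite tridiag_mulmx !mxE -val_eqE /=.
rewrite /invGamma_diag /Bdiag /F.
have := ltn_ord i; have := ltn_ord j; rewrite !ltnS.
move: (i : nat) (j : nat) => {}i {}j jN iN.
have [ij|ji|<-] := ltngtP i j; rewrite ?mulr0n ?mulr1n.
- rewrite (leq_trans ij jN) (leq_ltn_trans (leq_pred i) ij).
  have [<-|ji] := eqVneq j i.+1.
    by rewrite ltnn ?eqxx; case: ifP => _; ring.
  have -> : (i.+1 < j)%N by lia.
  have -> : (i == j.+1) = false by lia.
  by case: ifP => _; ring.
- have -> : (i.+1 < j)%N = false by lia.
  have -> : (i.+1 == j) = false by lia.
  have -> : (i.-1 < j)%N = false by lia.
  have -> : (j == i.+1) = false by lia.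
  rewrite (leq_ltn_trans (leq0n _) ji) /=.
  have -> : (i.+1 - j)%N = (i.-1 - j).+2 by lia.
  have -> : (i - j)%N = (i.-1 - j).+1 by lia.
  (* On the subdiagonal the row above contributes the diagonal entry [k] instead of the geometric
     value 1, which leaves [- (a * (k - 1))]. *)
  have [->|ij] := eqVneq i j.+1.
    by rewrite /= eqxx subnn; case: ifP => _; rewrite !exprS expr0; ring.
  rewrite (_ : (i.-1 == j) = false); last by lia.
  by case: ifP => _; rewrite !exprS; ring.
- have -> : (i.+1 < i)%N = false by lia.
  have -> : (i.+1 == i) = false by lia.
  rewrite subSnn.
  case: posnP => [->|i0] /=; first by rewrite N0; ring.
  rewrite (_ : (i.-1 < i)%N); last by lia.
  by case: ltngtP iN => // _ _; ring.
Qed.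

Lemma BmatE a theta N : (0 < N)%N -> a ^+ 2 < 1 ->
  let k := 2 * theta + 1 / 2 in
  Bmat N.+1 a theta =
    tridiag (- (a * (k - 1))) (- (a * k)) (Bdiag a k N) N.+1.
Proof.
move=> N0 a1 k; set G := tridiag (- a) (- a) (invGamma_diag a N) N.+1.
have a0 : 1 - a ^+ 2 != 0 by rewrite gt_eqF // subr_gt0.
have GK : (1 - a ^+ 2)^-1 *: G *m Gamma N.+1 a = 1%:M.
  by rewrite -scalemxAl tridiag_Gamma // scale_scalar_mx mulVf.
have Gu := (mulmx1_unit GK).2.
rewrite /Bmat (_ : invmx _ = (1 - a ^+ 2)^-1 *: G); last first.
  by rewrite -[RHS](mulmxK Gu) GK mul1mx.
rewrite scalerDr -scalemxAl scalerA mulfV // scale1r tridiag_tGamma //.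
by rewrite scale_scalar_mx mulr1 addrC subrK.
Qed.

(** The bound on [m] keeps every [inord] in [delta] away from its default value. *)
Lemma deltaE a theta N m : (0 < N)%N -> a ^+ 2 < 1 -> (m <= N.+1)%N ->
  let kappa := 2 * theta + 1 / 2 in
  delta N a theta m =
    \det (tridiag (- (a * (kappa - 1))) (- (a * kappa)) (Bdiag a kappa N) m).
Proof.
move=> N0 a1 mN kappa; congr (\det _); apply/matrixP => i j.
rewrite mxE BmatE // !mxE !inordK //; exact: (leq_trans (ltn_ord _) mN).
Qed.

(** This is [P_rec] for [P j = phiaux a k (N - j)], which is [phi] at [j + 2]. *)
Lemma phiaux_rec a k N i : (i < N)%N ->
  phiaux a k (N - i) = Bdiag a k N i.+1 * phiaux a k (N - i.+1)
    - (if (i.+1 < N)%N then (a * k) * (a * (k - 1)) * phiaux a k (N - i.+2) else 0).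
Proof.
move=> iN; rewrite /Bdiag /=.
have [<-|iN1] := eqVneq i.+1 N; first by rewrite ltnn subSnn subnn /=; ring.
rewrite ltn_neqAle iN1 iN.
have -> : (N - i)%N = (N - i.+2).+2 by lia.
have -> : (N - i.+1)%N = (N - i.+2).+1 by lia.
by rewrite /=; ring.
Qed.

Lemma nuvecE a theta N (i : 'I_N.+1) :
    (0 < N)%N -> a ^+ 2 < 1 -> 0 <= theta ->
  let k := 2 * theta + 1 / 2 in
  let X := tridiag_adj (a * k) (a * (k - 1)) (Bdiag a k N)
             (fun j => phiaux a k (N - j)) in
  nuvec N.+1 a theta i 0 = (1 - a) / delta N a theta N.+1 *
    (X i 0%N + (1 - a) * \sum_(2 <= j < N.+1) X i j.-1 + X i N).
Proof.
move=> N0 a1 th0 k X.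
set A := Gamma N.+1 a + tGamma N.+1 a + (2 * theta)%:M.
have Au : A \in unitmx.
  have := @unitmx_tGamma _ N a 2 1 (2 * theta) a1.
  rewrite scale1r scaler_nat mulr2n => H.
  by rewrite /A /Gamma (addrAC (tGamma _ _)) H // mulr_ge0.
set G := tridiag (- a) (- a) (invGamma_diag a N) N.+1.
have a0 : 1 - a ^+ 2 != 0 by rewrite gt_eqF // subr_gt0.
have Gu : G \in unitmx.
  have : (1 - a ^+ 2)^-1 *: G *m Gamma N.+1 a = 1%:M.
    by rewrite -scalemxAl tridiag_Gamma // scale_scalar_mx mulVf.
  by case/mulmx1_unit; rewrite unitmxZ // unitfE invr_eq0.
set C := tridiag (- (a * (k - 1))) (- (a * k)) (Bdiag a k N) N.+1.
have GA : G *m A = C.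
  by rewrite /A -addrA mulmxDr tridiag_Gamma // tridiag_tGamma // addrC subrK.
(* The minor is the determinant of [G *m A], a product of invertible matrices. *)
have d0 : delta N a theta N.+1 != 0.
  by rewrite deltaE // -/C -GA -unitfE -unitmxE unitmx_mul Gu.
pose Y := \matrix_(i < N.+1, j < N.+1) X i j.
have CY : C *m Y = (delta N a theta N.+1)%:M.
  rewrite deltaE //; apply: tridiag_mul_adj => [|j jN]; first by rewrite subnn.
  exact: phiaux_rec.
have YC : Y *m C = (delta N a theta N.+1)%:M.
  have : C *m ((delta N a theta N.+1)^-1 *: Y) = 1%:M.
    by rewrite -scalemxAr CY scale_scalar_mx mulVf.
  move/mulmx1C; rewrite -scalemxAl => /(congr1 ( *:%R (delta N a theta N.+1))).
  by rewrite scalerA mulfV // scale1r scale_scalar_mx mulr1.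
have Anu : A *m nuvec N.+1 a theta = ones R N.+1 by rewrite mulKVmx.
have : delta N a theta N.+1 *: nuvec N.+1 a theta = Y *m (G *m ones R N.+1).
  by rewrite -Anu (mulmxA G) GA mulmxA YC mul_scalar_mx.
move/colP/(_ i); rewrite mxE => nuE.
rewrite -[LHS](mulKf d0) nuE [(1 - a) / _]mulrC -mulrA mxE; congr (_ * _).
(* [w] is [G] applied to the all-ones vector: [1 - a] in the end rows, [1 - 2 a + a^2] in the
   others. *)
pose w j : R := (1 - a) * (if (0 < j < N)%N then 1 - a else 1).
have G1 (j : 'I_N.+1) : (G *m ones R N.+1) j 0 = w j.
  have -> : ones R N.+1 = \matrix_(i < N.+1, j < 1) 1.
    by apply/matrixP => ? ?; rewrite !mxE.
  rewrite (tridiag_mulmx _ _ _ _ _ (fun _ _ => 1)) /invGamma_diag /w.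
  have := ltn_ord j; rewrite ltnS.
  case: posnP => [->|j0] /=; first by rewrite N0 => _; ring.
  by case: ltnP => _ _; ring.
under eq_bigr => j _ do rewrite mxE G1.
rewrite -(big_mkord xpredT (fun j => X i j * w j)).
rewrite big_nat_recr //= big_ltn // [in RHS]big_add1 /=.
have -> : \sum_(1 <= j < N) X i j * w j =
    (\sum_(1 <= j < N) X i j) * ((1 - a) * (1 - a)).
  by rewrite mulr_suml; apply: eq_big_nat => j jN; rewrite /w jN.
by rewrite /w !ltnn andbF /=; ring.
Qed.

Lemma omegavecE a theta N (i : 'I_N.+1) :
    0 < a < 1 -> 0 <= theta ->
  let k := 2 * theta + 1 / 2 in
  omegavec N.+1 a theta i 0 =
    ((1 - a) * k + a * (a * (k - 1) / k) ^+ (N - i)) / (k * (k - a * (k - 1))).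
Proof.
move=> /andP[a0 a1] th0 k.
have k0 : 0 < k by rewrite /k; lra.
have kne : k != 0 by rewrite gt_eqF.
have q0 : 0 < k - a * (k - 1).
  have -> : k - a * (k - 1) = k * (1 - a) + a by ring.
  by rewrite addr_gt0 // mulr_gt0 // subr_gt0.
have qne : k - a * (k - 1) != 0 by rewrite gt_eqF.
(* The closed form counted from the last row, [m = N - i]. The last row gives [f0]; subtracting [a]
   times the next row from a row gives [fS]. *)
pose f m := ((1 - a) * k + a * (a * (k - 1) / k) ^+ m) / (k * (k - a * (k - 1))).
have f0 : k * f 0%N = 1.
  by rewrite /f expr0; field; rewrite ?qne ?kne.
have fS m : k * f m.+1 = 1 - a + a * (k - 1) * f m.
  by rewrite /f exprS; field; rewrite ?qne ?kne.
rewrite -/(f _) /omegavec [Gamma _ _]addrC addrK.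
set U := (_ + _).
have Uu : U \in unitmx.
  have := @unitmx_tGamma _ N a 0 1 (2 * theta).
  rewrite scale0r scale1r !add0r; apply=> //; last by rewrite mulr_ge0.
  by rewrite expr_lt1 // ltW.
suff -> : ones R N.+1 = U *m \col_(j < N.+1) f (N - j)%N by rewrite mulKmx // mxE.
apply/colP => {}i; rewrite !mxE.
transitivity (\sum_(j < N.+1) ((if j == i :> nat then k * f (N - j)%N else 0)
   + (if (i < j)%N then a ^+ (j - i) * f (N - j)%N else 0))); last first.
  apply: eq_bigr => j _; rewrite !mxE -!val_eqE /=.
  case: ltngtP => _; rewrite ?mulr0n ?mulr1n ?addr0 ?add0r ?mul0r //.
  by rewrite /k addrC.
rewrite big_split -!big_mkcond /= (big_ord1_eq _ (fun j => k * f (N - j)%N)) ltn_ord.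
rewrite -(big_mkord (fun j => i < j)%N (fun j => a ^+ (j - i) * f (N - j)%N)).
rewrite -(big_nat_widenl _ 0 _ xpredT) //.
have iN : (i <= N)%N by rewrite -ltnS.
(* By row [j - 1], the part of row [i] from column [j] on should equal
   [a ^+ (j - i.+1) * (1 - k * f (N.+1 - j))]; its negative is the primitive. At [j = N.+1] it
   vanishes by [f0]. *)
rewrite (telescope_sumr_eq
  (fun j => - (a ^+ (j - i.+1) * (1 - k * f (N.+1 - j)%N)))) //.
  by rewrite subnn f0 subnn subSS; ring.
move=> j /andP[ij jN].
have -> : (j - i)%N = (j - i.+1).+1 by lia.
have -> : (j.+1 - i.+1)%N = (j - i.+1).+1 by lia.
have -> : (N.+1 - j)%N = (N - j).+1 by lia.
by rewrite subSS fS exprS; ring.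
Qed.

End KernelMatrices.

(** * The closed formulas in one-based indices *)

Theorem theorem5p4 (R : realType) (rho T theta : R) (N : nat) :
  0 < rho -> 0 < T -> 0 <= theta -> (2 <= N)%N ->
  let alpha := expR (- (rho * T / N%:R)) in
  let kappa := 2 * theta + 1 / 2 in
  let omega := fun i : nat => omegavec N.+1 alpha theta (inord i.-1) 0 in
  let nu := fun i : nat => nuvec N.+1 alpha theta (inord i.-1) 0 in
  let dlt := delta N alpha theta in
  let ph := phi N alpha kappa in
  (forall i : nat, (1 <= i <= N.+1)%N ->
     omega i = ((1 - alpha) * kappa
                + alpha * (alpha * (kappa - 1) / kappa) ^+ (N.+1 - i))
               / (kappa * (kappa - alpha * (kappa - 1))))
  /\ omega N.+1 = 1 / kappa
  /\ nu 1%N = (1 - alpha) / dlt N.+1 *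
        (ph 2%N + (1 - alpha) * \sum_(2 <= j < N.+1) (alpha * kappa) ^+ j.-1 * ph j.+1
         + (alpha * kappa) ^+ N)
  /\ nu N.+1 = (1 - alpha) / dlt N.+1 *
        ((alpha * (kappa - 1)) ^+ N
         + (1 - alpha) * \sum_(2 <= j < N.+1) (alpha * (kappa - 1)) ^+ (N.+1 - j) * dlt j.-1
         + dlt N)
  /\ (forall i : nat, (2 <= i <= N)%N ->
        nu i = (1 - alpha) / dlt N.+1 *
          ((alpha * (kappa - 1)) ^+ i.-1 * ph i.+1
           + (1 - alpha) * \sum_(2 <= j < i) (alpha * (kappa - 1)) ^+ (i - j) * dlt j.-1 * ph i.+1
           + (1 - alpha) * \sum_(i <= j < N.+1) (alpha * kappa) ^+ (j - i) * dlt i.-1 * ph j.+1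
           + (alpha * kappa) ^+ (N.+1 - i) * dlt i.-1)).
Proof.
move=> rho0 T0 th0 N2 a k omega nu dlt ph.
have a0 : 0 < a by exact: expR_gt0.
have a1 : a < 1.
  by rewrite expR_lt1 oppr_lt0 divr_gt0 ?mulr_gt0 // ltr0n; lia.
have aa1 : a ^+ 2 < 1 by rewrite expr_lt1 // ltW.
have k0 : k != 0 by rewrite gt_eqF // /k; lra.
have N0 : (0 < N)%N by lia.
have omegaE i : (1 <= i <= N.+1)%N -> omega i =
    ((1 - a) * k + a * (a * (k - 1) / k) ^+ (N.+1 - i)) / (k * (k - a * (k - 1))).
  move=> iN; rewrite /omega omegavecE ?a0 // inordK; last by lia.
  by have -> : (N - i.-1)%N = (N.+1 - i)%N by lia.
pose X := tridiag_adj (a * k) (a * (k - 1)) (Bdiag a k N)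
            (fun j => phiaux a k (N - j)).
have nuE i : (1 <= i <= N.+1)%N -> nu i = (1 - a) / dlt N.+1 *
    (X i.-1 0%N + (1 - a) * \sum_(2 <= j < N.+1) X i.-1 j.-1 + X i.-1 N).
  by move=> iN; rewrite /nu nuvecE // inordK //; lia.
have phE i : (1 <= i)%N -> phiaux a k (N - i.-1) = ph i.+1.
  by move=> i1; rewrite /ph /phi; congr phiaux; lia.
(* The diagonal belongs to [Xu]; [Xl] covers only the entries strictly below it. *)
have Xu i j : (1 <= i <= j)%N -> (j <= N.+1)%N ->
    X i.-1 j.-1 = (a * k) ^+ (j - i) * dlt i.-1 * ph j.+1.
  move=> ij jN; rewrite /X /tridiag_adj ifT; last by lia.
  rewrite phE; last by lia.
  rewrite /dlt deltaE //; last by lia.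
  by have -> : (j.-1 - i.-1)%N = (j - i)%N by lia.
have Xl i j : (1 <= j < i)%N -> (i <= N.+1)%N ->
    X i.-1 j.-1 = (a * (k - 1)) ^+ (i - j) * dlt j.-1 * ph i.+1.
  move=> ji iN; rewrite /X /tridiag_adj ifF; last by lia.
  rewrite phE; last by lia.
  rewrite /dlt deltaE //; last by lia.
  by have -> : (i.-1 - j.-1)%N = (i - j)%N by lia.
have dlt0 : dlt 0%N = 1 by rewrite /dlt /delta det_mx00.
have ph_last : ph N.+2 = 1 by rewrite -phE // subnn.
split=> //; split.
  rewrite omegaE ?leqnn // subnn expr0; field.
  have -> : k - a * (k - 1) = k * (1 - a) + a by ring.
  by rewrite k0 gt_eqF // addr_gt0 // mulr_gt0 ?subr_gt0 // /k; lra.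
split.
  rewrite nuE // (Xu 1%N 1%N) // (Xu 1%N N.+1) // dlt0 ph_last !subn1 expr0.
  rewrite !(mulr1, mul1r); congr (_ * (_ + _ * _ + _)).
  apply: eq_big_nat => j jN; rewrite (Xu 1%N j) ?subn1 ?dlt0 ?mulr1 //; lia.
split.
  rewrite nuE; last by lia.
  rewrite (Xl N.+1 1%N) // (Xu N.+1 N.+1) ?leqnn // dlt0 ph_last subnn !subn1 expr0.
  rewrite !(mulr1, mul1r); congr (_ * (_ + _ * _ + _)).
  apply: eq_big_nat => j jN; rewrite (Xl N.+1 j) ?ph_last ?mulr1 //; lia.
move=> i iN; rewrite nuE; last by lia.
rewrite (Xl i 1%N) ?(Xu i N.+1); [|lia..].
(* The sum over the interior columns is cut at the diagonal [j = i], where the form of the entries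
   changes. *)
rewrite dlt0 ph_last subn1 !mulr1 (@big_cat_nat _ _ _ i) /=; [|lia..].
rewrite [(1 - a) * (_ + _)]mulrDr addrA; congr (_ * (_ + _ * _ + _ * _ + _)).
  by apply: eq_big_nat => j jN; apply: Xl; lia.
by apply: eq_big_nat => j jN; apply: Xu; lia.
Qed.
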